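(* Let $I^d\subsetneq\mathbb{R}^d$ be a proper interval with the restricted Borel $\sigma$-algebra, let $\mu$ be a probability measure on it, and let $f:I^d\to I^d$ be an ergodic $\mu$-preserving transformation. Then the permutation entropy rate of $f$ equals its metric (Kolmogorov–Sinai) entropy rate: $h^*_\mu(f)=h_\mu(f)$.
   Context: Product partitions: $\iota=\prod_{k=1}^d\{I_{1,k},\ldots,I_{N_k,k}\}$ is a partition of $I^d$ into $N_1\cdots N_d$ subintervals, the $k$-th factor splitting the $k$-th coordinate range into $N_k$ consecutive intervals of lengths $\Delta_{j,k}$; its norm is $\|\iota\|=\max_{j,k}\Delta_{j,k}$. The cells are enumerated lexicographically as $\iota=\{I^d_i:1\le i\le N_1\cdots N_d\}$ with $I^d_i<I^d_{i+1}$. The simple observations of $f$ with respect to $\iota$ are the finite-alphabet stationary process $\mathbf{S}^\iota=(S^\iota_n)_{n\ge0}$ on $(I^d,\mu)$ defined by $S^\iota_n(x)=i$ iff $f^n(x)\in I^d_i$, with alphabet $\{1,\ldots,N_1\cdots N_d\}$ ordered as integers. For a finite-alphabet process $\mathbf{S}$, the rank variables are $R_n=\sum_{i\le n}\delta(S_i\le S_n)$ (indices running over the observed block starting at its first element; $\delta(P)=1$ if $P$ holds, else $0$) and the permutation entropy rate is $h^*_m(\mathbf{S})=\lim_{L\to\infty}\frac{1}{L-1}H(R_1^L)$ (Shannon entropy, base 2, of the rank word of a block of length $L$). The permutation entropy rate of $f$ is $h^*_\mu(f):=\lim_{\|\iota\|\to0}h^*_m(\mathbf{S}^\iota)$. The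 metric entropy rate is $h_\mu(f)=\sup_\alpha\lim_{L\to\infty}\frac1L H_\mu\big(\bigvee_{i=0}^{L-1}f^{-i}\alpha\big)$, the supremum over finite measurable partitions $\alpha$, with $H_\mu(\beta)=-\sum_{B\in\beta}\mu(B)\log_2\mu(B)$. *)

(* Defs.v *)
From mathcomp Require Import all_boot all_order all_algebra.
From mathcomp Require Import all_classical all_reals all_analysis.
Import Order.TTheory GRing.Theory Num.Theory.
Import numFieldNormedType.Exports.

Set Implicit Arguments.
Unset Strict Implicit.
Unset Printing Implicit Defensive.

Local Open Scope classical_set_scope.
Local Open Scope ring_scope.

Definition Rd (R : realType) (d : nat) :=
  g_sigma_algebraType (open : set (set 'rV[R]_d)).

Section Defs.
Variables (R : realType) (d : nat).
Local Notation T := (Rd R d).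

Definition bounded_itv (i : interval R) : bool :=
  match i with Interval (BSide _ _) (BSide _ _) => true | _ => false end.

(* Length of a bounded interval (0 for unbounded ones, never used). *)
Definition itv_length (i : interval R) : R :=
  match i with Interval (BSide _ a) (BSide _ b) => b - a | _ => 0 end.

Definition box (Ik : 'I_d -> interval R) : set T :=
  [set x : T | forall k : 'I_d, (x : 'rV[R]_d) ord0 k \in Ik k].

Record prod_partition (Ik : 'I_d -> interval R) := ProdPartition {
  pp_N : 'I_d -> nat;
  pp_J : forall k : 'I_d, 'I_(pp_N k) -> interval R;
  pp_nonempty : forall (k : 'I_d) (j : 'I_(pp_N k)), exists x : R, x \in pp_J j;
  pp_cover : forall (k : 'I_d) (x : R),
      (x \in Ik k) = [exists j : 'I_(pp_N k), x \in pp_J j];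
  (* ... and are consecutive: I_{i,k} < I_{j,k} for i < j (this also  *)
  (* gives pairwise disjointness)                                    *)
  pp_order : forall (k : 'I_d) (i j : 'I_(pp_N k)) (x y : R),
      (i < j)%N -> x \in pp_J i -> y \in pp_J j -> x < y
}.

Variable Ik : 'I_d -> interval R.

Definition pp_norm (iota : prod_partition Ik) : R :=
  \big[Num.max/0]_(k < d) \big[Num.max/0]_(j < pp_N iota k)
     itv_length (pp_J j).

Definition coord_cell (iota : prod_partition Ik) (k : 'I_d) (x : T) : nat :=
  match [pick j : 'I_(pp_N iota k) | (x : 'rV[R]_d) ord0 k \in pp_J j] with
  | Some j => nat_of_ord j
  | None => 0%N
  end.

(* Lexicographic enumeration of the cells I^d_i, i = 1 .. N_1...N_d      *)
(* (first coordinate most significant): the symbol i with x in I^d_i.   *)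
Definition cell_index (iota : prod_partition Ik) (x : T) : nat :=
  (\sum_(k < d) coord_cell iota k x *
       \prod_(k' < d | (k < k')%N) pp_N iota k').+1.

Definition simple_obs (iota : prod_partition Ik) (f : T -> T) (n : nat)
  (x : T) : nat := cell_index iota (iter n f x).

Definition rank_var (S : nat -> T -> nat) (n : nat) (x : T) : nat :=
  \sum_(1 <= i < n.+1) (S i x <= S n x)%N.

(* Rank word R_1^L (entry m : 'I_L stands for R_{m+1}, a value <= L). *)
Definition rank_word (S : nat -> T -> nat) (L : nat) (x : T)
  : {ffun 'I_L -> 'I_L.+1} :=
  [ffun m : 'I_L => inord (rank_var S m.+1 x)].

Definition ent_term (p : R) : R :=
  if p == 0 then 0 else - (p * (ln p / ln 2)).

Definition rank_block_entropy (mu : set T -> \bar R) (X : set T)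
  (S : nat -> T -> nat) (L : nat) : R :=
  \sum_(w : {ffun 'I_L -> 'I_L.+1})
     ent_term (fine (mu (X `&` [set x | rank_word S L x = w]))).

Definition meas_partition (X : set T) (n : nat) (A : 'I_n -> set T) : Prop :=
  [/\ forall i, measurable (A i),
      forall i, A i `<=` X,
      forall i j, i != j -> A i `&` A j = set0
    & \bigcup_(i in [set: 'I_n]) A i = X].

(* H_mu( \/_{i=0}^{L-1} f^{-i} alpha ): the cells of the join are         *)
(* indexed by words w, cell_w = {x in I^d | f^i x in A_{w i}, i < L}.     *)
Definition join_entropy (mu : set T -> \bar R) (X : set T) (f : T -> T)
  (n : nat) (A : 'I_n -> set T) (L : nat) : R :=
  \sum_(w : {ffun 'I_L -> 'I_n})
     ent_term (fine (mu [set x | X x /\ forall i : 'I_L, A (w i) (iter i f x)])).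

Definition entropy_rate_part (mu : set T -> \bar R) (X : set T) (f : T -> T)
  (n : nat) (A : 'I_n -> set T) : R :=
  limn (fun L : nat => join_entropy mu X f A L / L%:R).

Definition metric_entropy (mu : set T -> \bar R) (X : set T) (f : T -> T)
  : \bar R :=
  ereal_sup [set e | exists (n : nat) (A : 'I_n -> set T),
                     meas_partition X A /\ e = (entropy_rate_part mu X f A)%:E].

End Defs.

(* Main.v *)
(* The rank word of a block records how every two of its symbols compare, so
   together with the number of occurrences of each symbol it determines the
   block.  Over M symbols there are at most (L+1)^M count vectors, hence the
   entropies of the rank word and of the block of length L differ by
   O(log L), and for each partition the permutation entropy rate is the
   Shannon entropy rate h(f, iota) of the simple observations.  It remains to let the norm tend to 0.  The sets that are
   approximated in measure by unions of cells of every fine enough partition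
   form a sigma-algebra containing the open sets, so every finite measurable
   partition alpha is approximated, H(alpha | iota) tends to 0, and
   h(f, alpha) <= h(f, iota) + H(alpha | iota). *)
Require Import Defs.
From mathcomp Require Import all_boot all_order all_algebra.
From mathcomp Require Import all_classical all_reals all_analysis.
From mathcomp Require Import lra ring zify.
Import Order.TTheory GRing.Theory Num.Theory.
Import numFieldNormedType.Exports.
Local Open Scope classical_set_scope.
Local Open Scope ring_scope.
Set Implicit Arguments.
Unset Strict Implicit.
Unset Printing Implicit Defensive.

(** * Entropy of finite distributions *)

(** The norm tends to 0 over arbitrary product partitions, not along a refining sequence, so no
    monotone or martingale limit in [iota] is available: one threshold on the norm has to serve
    every [iota] below it. Approximation in measure gives such a uniform statement, and a Fano-type
    bound converts a small error probability into a small conditional entropy. Partitions are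
    handled as finite-valued maps and conditional entropy is the difference
    [entropy (X, Y) - entropy Y]; its monotonicity then rests on strong subadditivity, and finally
    on [ln (1 + x) <= x]. *)

Section EntTerm.
Context {R : realType}.
Implicit Types p q : R.

Lemma ln2_gt0 : 0 < ln (2 : R).
Proof. by apply: ln_gt0; lra. Qed.

(** The case distinction disappears because the factor [p] cancels whatever value [ln] takes at
    0. *)
Lemma ent_termE p : ent_term p = - (p * ln p) / ln 2.
Proof.
rewrite /ent_term; case: eqP => [->|_]; first by rewrite mul0r oppr0 mul0r.
by rewrite mulNr mulrA.
Qed.

Lemma ent_term0 : ent_term (0 : R) = 0.
Proof. by rewrite /ent_term eqxx. Qed.

Lemma ent_term1 : ent_term (1 : R) = 0.
Proof. by rewrite ent_termE ln1 mulr0 oppr0 mul0r. Qed.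

Lemma ent_term_ge0 p : p <= 1 -> 0 <= p -> 0 <= ent_term p.
Proof.
move=> p1 p0; rewrite ent_termE divr_ge0 ?(ltW ln2_gt0)// -mulrN mulr_ge0//.
by rewrite oppr_ge0 ln_le0.
Qed.

(** Pointwise form of the nonnegativity of relative entropy, from [ln (1 + x) <= x] at
    [x = q / p - 1]. Summed over two families of equal mass, the left side vanishes. *)
Lemma gibbs_term p q : 0 <= p -> 0 <= q -> (0 < p -> 0 < q) ->
  p - q <= p * (ln p - ln q).
Proof.
rewrite le_eqVlt => /predU1P[<- q0 _|p0 _ /(_ p0) q0].
  by rewrite mul0r sub0r oppr_le0.
have /le_ln1Dx : -1 < q / p - 1 by rewrite ltrBrDr addNr divr_gt0.
rewrite addrC subrK ln_div ?posrE// => h.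
rewrite -opprB -[leRHS]opprK lerN2 -mulrN opprB.
apply: (@le_trans _ _ (p * (q / p - 1))); first by rewrite ler_pM2l.
by rewrite mulrBr mulr1 mulrC divfK// gt_eqF.
Qed.

Lemma ent_term_sum (I : finType) (p : I -> R) : (forall i, 0 <= p i) ->
  ent_term (\sum_i p i) <= \sum_i ent_term (p i).
Proof.
move=> p0; rewrite ent_termE (eq_bigr _ (fun i _ => ent_termE (p i))).
rewrite -mulr_suml ler_wpM2r ?invr_ge0 ?(ltW ln2_gt0)//.
rewrite mulr_suml -sumrN ler_sum// => i _; rewrite lerN2.
have /predU1P[<-|pi0] : (0 == p i) || (0 < p i) by rewrite -le_eqVlt.
  by rewrite !mul0r.
rewrite ler_pM2l//.
have h : p i <= \sum_j p j.
  by rewrite (bigD1 i)//= lerDl sumr_ge0.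
by rewrite ler_ln ?posrE// (lt_le_trans pi0).
Qed.

(** Mutual information is nonnegative: the Gibbs bound compares [p] with the product [x a * y b / s]
    of its marginals, which has the same mass [s]. The mass is left arbitrary so that slices of a
    larger table qualify; this accounts for the term in [s]. *)
Lemma ent_term_submod2 (A B : finType) (p : A -> B -> R) :
  (forall a b, 0 <= p a b) ->
  \sum_a \sum_b ent_term (p a b) + ent_term (\sum_a \sum_b p a b) <=
  \sum_a ent_term (\sum_b p a b) + \sum_b ent_term (\sum_a p a b).
Proof.
move=> p0; set s := \sum_a \sum_b p a b.
pose x a := \sum_b p a b; pose y b := \sum_a p a b.
have x0 a : 0 <= x a by exact: sumr_ge0.
have y0 b : 0 <= y b by exact: sumr_ge0.
have s0 : 0 <= s by apply: sumr_ge0 => a _; exact: x0.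
have sy : s = \sum_b y b by rewrite /s exchange_big.
have px a b : p a b <= x a by rewrite /x (bigD1 b)//= lerDl sumr_ge0.
have py a b : p a b <= y b by rewrite /y (bigD1 a)//= lerDl sumr_ge0.
have xs a : x a <= s by rewrite /s (bigD1 a)//= lerDl sumr_ge0// => i _; exact: x0.
have key : 0 <= \sum_a \sum_b
    p a b * (ln (p a b) + ln s - ln (x a) - ln (y b)).
  apply: (@le_trans _ _ (\sum_a \sum_b (p a b - x a * y b / s))).
    under eq_bigr do rewrite sumrB -mulr_suml -mulr_sumr.
    rewrite sumrB -mulr_suml -mulr_suml -sy -/s.
    have [->|sN0] := eqVneq s 0; first by rewrite mulr0 mul0r subrr.
    by rewrite mulfK// subrr.
  apply: ler_sum => a _; apply: ler_sum => b _.
  have h : 0 < p a b -> [/\ 0 < x a, 0 < y b & 0 < s].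
    by move=> pab; split; (apply: lt_le_trans pab _) => //; exact: le_trans (xs a).
  apply: (le_trans (@gibbs_term _ _ _ _ _)) => //.
  - by rewrite divr_ge0// mulr_ge0.
  - by move=> /h[? ? ?]; rewrite divr_gt0// mulr_gt0.
  have /predU1P[<-|pab] : (0 == p a b) || (0 < p a b) by rewrite -le_eqVlt.
    by rewrite !mul0r.
  have [? ? ?] := h pab.
  rewrite ln_div ?posrE ?mulr_gt0// lnM ?posrE//.
  by rewrite ler_pM2l//; lra.
have split4 : \sum_a \sum_b p a b * (ln (p a b) + ln s - ln (x a) - ln (y b)) =
    \sum_a \sum_b p a b * ln (p a b) + s * ln s
    - \sum_a x a * ln (x a) - \sum_b y b * ln (y b).
  have -> : \sum_b y b * ln (y b) = \sum_a \sum_b p a b * ln (y b).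
    by rewrite exchange_big; apply: eq_bigr => b _; rewrite mulr_suml.
  rewrite /s mulr_suml -big_split -!sumrB; apply: eq_bigr => a _ /=.
  rewrite /x !mulr_suml -big_split -!sumrB; apply: eq_bigr => b _ /=.
  by rewrite -/s; ring.
have entE (I : finType) (q : I -> R) :
    \sum_i ent_term (q i) = - (\sum_i q i * ln (q i)) / ln 2.
  by under eq_bigr do rewrite ent_termE; rewrite -mulr_suml sumrN.
rewrite !entE; under eq_bigr do rewrite entE.
rewrite -mulr_suml sumrN ent_termE -!mulrDl ler_pM2r ?invr_gt0 ?ln2_gt0//.
by move: key; rewrite split4 /x /y -/s; lra.
Qed.

Lemma ent_term_submod (A B C : finType) (p : A -> B -> C -> R) :
  (forall a b c, 0 <= p a b c) ->
  \sum_a \sum_b \sum_c ent_term (p a b c)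
    + \sum_c ent_term (\sum_a \sum_b p a b c) <=
  \sum_a \sum_c ent_term (\sum_b p a b c)
    + \sum_b \sum_c ent_term (\sum_a p a b c).
Proof.
move=> p0.
under eq_bigr do rewrite exchange_big.
rewrite exchange_big [X in _ <= X + _]exchange_big [X in _ <= _ + X]exchange_big.
by rewrite -!big_split ler_sum// => c _; exact: ent_term_submod2.
Qed.

Lemma ent_term_uniform (I : finType) (p : I -> R) : (forall i, 0 <= p i) ->
  \sum_i p i = 1 -> \sum_i ent_term (p i) <= ln #|I|%:R / ln 2.
Proof.
move=> p0 p1.
under eq_bigr do rewrite ent_termE.
rewrite -mulr_suml ler_pM2r ?invr_gt0 ?ln2_gt0//.
have [I0|I0] := posnP #|I|.
  move: p1; rewrite big1 => [/eqP|i]; first by rewrite eq_sym oner_eq0.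
  by have := fintype0 i I0.
have c0 : 0 < #|I|%:R :> R by rewrite ltr0n.
have : 0 <= \sum_i p i * (ln (p i) - ln (#|I|%:R^-1)).
  apply: (@le_trans _ _ (\sum_i (p i - #|I|%:R^-1))).
    by rewrite sumrB p1 sumr_const -[X in _ - X]mulr_natr mulVf ?gt_eqF// subrr.
  by apply: ler_sum => i _; apply: gibbs_term => //; rewrite ?invr_ge0 ?invr_gt0 ?ltW.
under eq_bigr do rewrite lnV ?posrE// opprK mulrDr.
by rewrite big_split/= -mulr_suml p1 mul1r sumrN; lra.
Qed.

(** Since [ln p] is twice [ln (sqrt p)]. This crude bound serves both the modulus of [ent_term] at 0
    and the growth of [ln L]. *)
Lemma ln_le_sqrt p : 0 < p -> ln p <= 2 * Num.sqrt p.
Proof.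
move=> p0; rewrite -{1}(sqr_sqrtr (ltW p0)) lnXn ?sqrtr_gt0//.
rewrite mulr2n mulrDl !mul1r lerD//; by apply/ltW/ln_sublinear; rewrite sqrtr_gt0.
Qed.

Lemma ent_term_le_sqrt p : 0 <= p -> ent_term p <= 2 * Num.sqrt p / ln 2.
Proof.
rewrite le_eqVlt => /predU1P[<-|p0]; first by rewrite ent_term0 sqrtr0 mulr0 mul0r.
rewrite ent_termE ler_pM2r ?invr_gt0 ?ln2_gt0// -mulrN -lnV ?posrE//.
apply: (@le_trans _ _ (p * (2 * Num.sqrt p^-1))).
  by rewrite ler_pM2l// ln_le_sqrt// invr_gt0.
rewrite sqrtrV ?(ltW p0)// mulrCA -{1}(sqr_sqrtr (ltW p0)) expr2 mulfK//.
by rewrite gt_eqF// sqrtr_gt0.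
Qed.

Lemma ent_term_compl p : 0 <= p -> p < 1 -> ent_term (1 - p) <= p / ln 2.
Proof.
move=> p0 p1; rewrite ent_termE ler_pM2r ?invr_gt0 ?ln2_gt0//.
by have := @gibbs_term (1 - p) 1; rewrite ln1; lra.
Qed.

End EntTerm.

(** * Entropy of finite-valued random variables *)

Section RandomVariables.
Context {disp : measure_display} {T : measurableType disp} {R : realType}.
Variables (mu : probability T R) (D : set T).
Hypothesis mD : measurable D.

Definition prob (E : set T) : R := fine (mu (D `&` E)).

Definition rv (A : finType) (X : T -> A) :=
  forall a, measurable (D `&` [set x | X x = a]).

Definition entropy (A : finType) (X : T -> A) : R :=
  \sum_a ent_term (prob [set x | X x = a]).

(** On [D], [X] factors through [Y]: the partition by [Y] refines the partition by [X]. *)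
Definition determined (A B : Type) (X : T -> A) (Y : T -> B) :=
  forall x y, D x -> D y -> Y x = Y y -> X x = X y.

Lemma prob_ge0 E : 0 <= prob E.
Proof. by rewrite fine_ge0. Qed.

Lemma prob_le1 E : measurable (D `&` E) -> prob E <= 1.
Proof.
by move=> mE; rewrite -lee_fin fineK ?fin_num_measure// probability_le1.
Qed.

Lemma eq_prob E F : D `&` E = D `&` F -> prob E = prob F.
Proof. by rewrite /prob => ->. Qed.

Lemma prob0 E : D `&` E = set0 -> prob E = 0.
Proof. by rewrite /prob => ->; rewrite measure0. Qed.

Lemma prob_split (A : finType) (X : T -> A) (E : set T) :
  measurable (D `&` E) -> rv X ->
  prob E = \sum_a prob [set x | E x /\ X x = a].
Proof.
move=> mE mX.
have mF a : measurable (D `&` [set x | E x /\ X x = a]).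
  have -> : D `&` [set x | E x /\ X x = a] =
      (D `&` E) `&` (D `&` [set x | X x = a]).
    by apply/seteqP; split=> x /=; tauto.
  exact: measurableI.
have EE : D `&` E = \bigcup_(a in [set` index_enum A])
    (D `&` [set x | E x /\ X x = a]).
  apply/seteqP; split=> [x [Dx Ex]|x [a _ [Dx [Ex _]]]] //.
  by exists (X x) => //=; rewrite mem_index_enum.
have tF : trivIset [set` index_enum A] (fun a => D `&` [set x | E x /\ X x = a]).
  by apply/trivIsetP => a b _ _ /eqP ab; apply/seteqP; split=> x //=;
     move=> [[_ [_ ->]] [_ [_ ?]]]; apply: ab.
rewrite {1}/prob EE measure_fin_bigcup//.
rewrite -fsbig_seq ?index_enum_uniq//= /prob sum_fine// => a _.
by rewrite fin_num_measure.
Qed.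

Lemma prob_sum1 (A : finType) (X : T -> A) : mu D = 1%E -> rv X ->
  \sum_a prob [set x | X x = a] = 1.
Proof.
move=> D1 mX; transitivity (prob setT); last by rewrite /prob setIT D1.
rewrite (prob_split _ mX) ?setIT//; apply: eq_bigr => a _; congr prob.
by apply/seteqP; split=> x //=; tauto.
Qed.

Lemma prob_le E F : measurable (D `&` E) -> measurable (D `&` F) ->
  D `&` E `<=` F -> prob E <= prob F.
Proof.
move=> mE mF EF; rewrite fine_le ?fin_num_measure// le_measure ?inE//.
by move=> x [Dx Ex]; split => //; exact: EF.
Qed.

Lemma probU E F : measurable (D `&` E) -> measurable (D `&` F) ->
  prob (E `|` F) <= prob E + prob F.
Proof.
move=> mE mF; rewrite /prob -fineD ?fin_num_measure//.
rewrite setIUr fine_le ?fin_num_measure//.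
- exact: measurableU.
- by rewrite fin_numD !fin_num_measure.
- exact: measureU2.
Qed.

Lemma rv_pair (A B : finType) (X : T -> A) (Y : T -> B) :
  rv X -> rv Y -> rv (fun x => (X x, Y x)).
Proof.
move=> mX mY [a b].
rewrite (_ : _ `&` _ = (D `&` [set x | X x = a]) `&` (D `&` [set x | Y x = b])).
  exact: measurableI.
apply/seteqP; split=> x /=; first by move=> [Dx [-> ->]].
by move=> [[Dx ->] [_ ->]].
Qed.

Lemma measurable_determined (A : finType) (X : T -> A) (P : set T) :
  rv X -> (forall x y, D x -> D y -> X x = X y -> P x -> P y) ->
  measurable (D `&` P).
Proof.
move=> mX dP.
rewrite (_ : _ `&` _ = \bigcup_(a in [set a | exists2 x, D x /\ P x & X x = a])
    (D `&` [set x | X x = a])).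
  by apply: fin_bigcup_measurable => // a _; exact: mX.
apply/seteqP; split=> x /=; first by move=> [Dx Px]; exists (X x) => //; exists x.
by move=> [a [y [Dy Py] <-] [Dx /esym e]]; split=> //; exact: dP Py.
Qed.

Lemma rv_determined (A B : finType) (X : T -> A) (Y : T -> B) :
  rv Y -> determined X Y -> rv X.
Proof.
by move=> mY XY a; apply: (measurable_determined mY) => x y Dx Dy /(XY _ _ Dx Dy) /= ->.
Qed.

Lemma rv_cst (A : finType) (a : A) : rv (fun=> a).
Proof.
move=> b; have [->|/eqP ab] := eqVneq a b.
  by rewrite (_ : _ `&` _ = D)//; apply/seteqP; split=> x //= [].
by rewrite (_ : _ `&` _ = set0)//; apply/seteqP; split=> x //= [].
Qed.

Lemma rv_ffun (I A : finType) (X : I -> T -> A) :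
  (forall i, rv (X i)) -> rv (fun x => [ffun i => X i x]).
Proof.
move=> mX w.
(* Complementing inside [D] turns each coordinate condition into a measurable set; the bare level
   set of [X i] may fail to be measurable off [D]. *)
rewrite (_ : _ `&` _ = D `&` \bigcap_(i in [set: I]) (~` (D `\` [set x | X i x = w i]))).
  apply: measurableI => //; apply: fin_bigcap_measurable => // i _.
  apply: measurableC; rewrite (_ : _ `\` _ = D `\` (D `&` [set x | X i x = w i])).
    by apply: measurableD => //; exact: mX.
  by apply/seteqP; split=> x /=; tauto.
apply/seteqP; split=> x /=.
  move=> [Dx e]; split=> // i _ [_]; apply.
  by rewrite /= -e ffunE.
move=> [Dx h]; split=> //; apply/ffunP => i; rewrite ffunE.
by have := h i Logic.I; move=> /not_andP[//|/contrapT].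
Qed.

(** Splitting each atom of [X] along [Y] only raises the entropy, and in the resulting table each
    value of [Y] has at most one nonzero entry, its whole mass. *)
Lemma entropy_le_determined (A B : finType) (X : T -> A) (Y : T -> B) :
  rv Y -> determined X Y -> entropy X <= entropy Y.
Proof.
move=> mY XY; have mX := rv_determined mY XY.
pose p a b := prob [set x | X x = a /\ Y x = b].
rewrite /entropy; under eq_bigr => a _ do rewrite (prob_split (mX a) mY).
apply: (@le_trans _ _ (\sum_a \sum_b ent_term (p a b))).
  by apply: ler_sum => a _; apply: ent_term_sum => b; exact: prob_ge0.
rewrite exchange_big/=; apply: ler_sum => b _.
have [[x0 [Dx0 Yx0]]|/forallNP noY] := pselect (exists x, D x /\ Y x = b).
  rewrite (bigD1 (X x0))//= big1 ?addr0 => [|a aX].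
    rewrite (_ : p _ _ = prob [set x | Y x = b])//; apply: eq_prob.
    apply/seteqP; split=> x /=; first tauto.
    by move=> [Dx Yx]; repeat split=> //; apply: XY => //; rewrite Yx.
  rewrite /p prob0 ?ent_term0//; apply/seteqP; split=> x //= [Dx [Xx Yx]].
  by move/eqP: aX; apply; rewrite -Xx; apply: XY => //; rewrite Yx.
rewrite big1; last first.
  move=> a _; rewrite /p prob0 ?ent_term0//; apply/seteqP; split=> x //=.
  by move=> [Dx [_ ?]]; apply: (noY x).
rewrite prob0 ?ent_term0//; apply/seteqP; split=> x //= [Dx Yx].
by apply: (noY x).
Qed.

Lemma entropy_eq_determined (A B : finType) (X : T -> A) (Y : T -> B) :
  rv Y -> determined X Y -> determined Y X -> entropy X = entropy Y.
Proof.
move=> mY XY YX; have mX := rv_determined mY XY.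
by apply/eqP; rewrite eq_le !entropy_le_determined.
Qed.

Lemma entropy_ge0 (A : finType) (X : T -> A) : rv X -> 0 <= entropy X.
Proof.
by move=> mX; apply: sumr_ge0 => a _; rewrite ent_term_ge0 ?prob_ge0 ?prob_le1//; exact: mX.
Qed.

(** Strong subadditivity, i.e. nonnegativity of the conditional mutual information of [X] and [Y]
    given [Z]. *)
Lemma entropy_submod (A B C : finType) (X : T -> A) (Y : T -> B) (Z : T -> C) :
  rv X -> rv Y -> rv Z ->
  entropy (fun x => (X x, Y x, Z x)) + entropy Z <=
  entropy (fun x => (X x, Z x)) + entropy (fun x => (Y x, Z x)).
Proof.
move=> mX mY mZ.
pose p a b c := prob [set x | X x = a /\ Y x = b /\ Z x = c].
have pXZ a c : prob [set x | (X x, Z x) = (a, c)] = \sum_b p a b c.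
  rewrite (prob_split (rv_pair mX mZ (a, c)) mY); apply: eq_bigr => b _.
  by congr prob; apply/seteqP; split=> x /=; [move=> [[-> ->] ->]|move=> [-> [-> ->]]].
have pYZ b c : prob [set x | (Y x, Z x) = (b, c)] = \sum_a p a b c.
  rewrite (prob_split (rv_pair mY mZ (b, c)) mX); apply: eq_bigr => a _.
  by congr prob; apply/seteqP; split=> x /=; [move=> [[-> ->] ->]|move=> [-> [-> ->]]].
have pZ c : prob [set x | Z x = c] = \sum_a \sum_b p a b c.
  rewrite (prob_split (mZ c) mX); apply: eq_bigr => a _; rewrite -pXZ.
  by congr prob; apply/seteqP; split=> x /=; [move=> [-> ->]|move=> [-> ->]].
have pXYZ a b c : prob [set x | (X x, Y x, Z x) = (a, b, c)] = p a b c.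
  by congr prob; apply/seteqP; split=> x /=; [move=> [-> -> ->]|move=> [-> [-> ->]]].
have := @ent_term_submod R A B C p (fun _ _ _ => prob_ge0 _).
rewrite /entropy; congr (_ + _ <= _ + _).
- rewrite pair_bigA pair_bigA/=; apply: eq_bigr => -[[a b] c] _ /=.
  by rewrite pXYZ.
- by apply: eq_bigr => c _; rewrite pZ.
- by rewrite pair_bigA/=; apply: eq_bigr => -[a c] _; rewrite pXZ.
- by rewrite pair_bigA/=; apply: eq_bigr => -[b c] _; rewrite pYZ.
Qed.

Hypothesis D1 : mu D = 1%E.

Lemma entropy_cst (A : finType) (a : A) : entropy (fun=> a) = 0.
Proof.
rewrite /entropy (bigD1 a)//= big1 ?addr0 => [|b ba].
  rewrite (_ : prob _ = 1) ?ent_term1//.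
  by rewrite /prob (_ : _ `&` _ = D) ?D1//; apply/seteqP; split=> x //= [].
rewrite prob0 ?ent_term0//; apply/seteqP; split=> x //= [_ /eqP].
by rewrite eq_sym (negbTE ba).
Qed.

Lemma entropy_pair_le (A B : finType) (X : T -> A) (Y : T -> B) :
  rv X -> rv Y -> entropy (fun x => (X x, Y x)) <= entropy X + entropy Y.
Proof.
move=> mX mY; have mu1 := rv_cst tt.
have := entropy_submod mX mY mu1; rewrite entropy_cst addr0.
have dropE (C : finType) (Z : T -> C) : rv Z ->
    entropy (fun x => (Z x, tt)) = entropy Z.
  by move=> mZ; apply: entropy_eq_determined => // x y _ _ => [->|[]].
by rewrite (dropE _ _ mX) (dropE _ _ mY) (dropE _ _ (rv_pair mX mY)).
Qed.

Lemma entropy_le_card (A : finType) (X : T -> A) : rv X ->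
  entropy X <= ln #|A|%:R / ln 2.
Proof.
by move=> mX; apply: ent_term_uniform; [move=> a; exact: prob_ge0|exact: prob_sum1].
Qed.

(** Conditioning on less information increases conditional entropy: this is strong subadditivity
    once the redundant [Z] is dropped next to [Y]. *)
Lemma condentropy_le (A B C : finType) (X : T -> A) (Y : T -> B) (Z : T -> C) :
  rv X -> rv Y -> determined Z Y ->
  entropy (fun x => (X x, Y x)) - entropy Y <=
  entropy (fun x => (X x, Z x)) - entropy Z.
Proof.
move=> mX mY ZY; have mZ := rv_determined mY ZY.
have := entropy_submod mX mY mZ.
rewrite (@entropy_eq_determined _ _ (fun x => (Y x, Z x)) Y)//; last 2 first.
  by move=> x y Dx Dy e; rewrite e (ZY x y).
  by move=> x y _ _ [].
rewrite (@entropy_eq_determined _ _ (fun x => (X x, Y x, Z x)) (fun x => (X x, Y x)))//; last 3 first.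
- exact: rv_pair.
- by move=> x y Dx Dy [-> e]; rewrite e (ZY x y).
- by move=> x y _ _ [-> ->].
lra.
Qed.

(** Crude Fano inequality. The correction [E] is [None] on agreement and reveals [X] otherwise, so
    [E] and [Y] determine [X] and the difference is at most the entropy of [E]. Its [None] atom has
    mass [1 - q], each other atom at most [q]. *)
Lemma entropy_fano (A : finType) (X Y : T -> A) : rv X -> rv Y ->
  prob [set x | X x <> Y x] < 1 ->
  entropy (fun x => (X x, Y x)) - entropy Y <=
  (prob [set x | X x <> Y x]
    + 2 * Num.sqrt (prob [set x | X x <> Y x]) *+ #|A|) / ln 2.
Proof.
move=> mX mY; set q := prob _ => q1.
pose E x := if X x == Y x then None else Some (X x).
have mXY := rv_pair mX mY.
have mE : rv E by apply: rv_determined mXY _ => x y _ _ [eX eY]; rewrite /E eX eY.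
have mq : measurable (D `&` [set x | X x <> Y x]).
  by apply: (measurable_determined mXY) => x y _ _ [/= -> ->].
have : entropy (fun x => (X x, Y x)) <= entropy E + entropy Y.
  apply: le_trans (entropy_pair_le mE mY).
  apply: entropy_le_determined; first exact: rv_pair.
  move=> x y _ _ [eE eY]; move: eE; rewrite /E eY.
  case: (X x =P Y y) => [->|_]; case: (X y =P Y y) => [->|_] //.
  by move=> [->].
rewrite -lerBlDr => /le_trans; apply.
have eS (a : A) : ent_term (prob [set x | E x = Some a]) <= 2 * Num.sqrt q / ln 2.
  apply: le_trans (ent_term_le_sqrt (prob_ge0 _)) _.
  rewrite ler_pM2r ?invr_gt0 ?ln2_gt0// ler_pM2l// ler_sqrt ?prob_ge0//.
  apply: prob_le; [exact: (mE (Some a))|exact: mq|].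
  by move=> x [Dx] /=; rewrite /E; case: eqP.
have eN : prob [set x | E x = None] = 1 - q.
  apply/eqP; rewrite eq_sym subr_eq; apply/eqP.
  have := prob_sum1 D1 (rv_determined mE (X := fun x => E x == None) _) .
  rewrite big_bool/= => <-; last by move=> x y _ _ ->.
  congr (prob _ + prob _); apply/seteqP; rewrite /E; split => x /=; case: (X x =P Y x) => //=.
rewrite /entropy (bigD1 (None : option A))//= eN mulrDl lerD ?ent_term_compl ?prob_ge0//.
rewrite -mulr_natr mulrAC.
apply: (@le_trans _ _ (\sum_(a : A) 2 * Num.sqrt q / ln 2)); last first.
  by rewrite sumr_const mulr_natr.
rewrite (reindex_omap Some id)/=; last by case.
by rewrite (eq_bigl xpredT) ?ler_sum// => a; rewrite eqxx.
Qed.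

End RandomVariables.

(** * Rank words and subadditive sequences *)

Section Ranks.
Local Open Scope nat_scope.
Implicit Types (s t : nat -> nat) (r : seq nat).

Lemma eq_sum_bool_sub (a b : pred nat) r :
  {in r, forall i, a i -> b i} ->
  \sum_(i <- r) a i = \sum_(i <- r) b i -> {in r, a =1 b}.
Proof.
elim: r => [//|j r IH] ab; rewrite !big_cons => e.
have abr : {in r, forall i, a i -> b i}.
  by move=> i ir; apply: ab; rewrite inE ir orbT.
have le_r : \sum_(i <- r) a i <= \sum_(i <- r) b i.
  rewrite big_seq [leqRHS]big_seq; apply: leq_sum => i /abr.
  by case: (a i) => // ->.
have abj : a j -> b j by apply: ab; rewrite inE eqxx.
have ej : a j = b j.
  by move: abj e; case: (a j) (b j) => [] [] //= => [/(_ isT)|_] //; lia.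
move=> i; rewrite inE => /predU1P[->//|]; apply: IH => //.
by move: e; rewrite ej => /addnI.
Qed.

(* The rank of [j] is the number of earlier indices below it; for two words
   inducing the same order on the earlier indices these down-sets are nested,
   so equal ranks force them to coincide. *)
Lemma rank_order s t L :
  (forall n, 0 < n <= L ->
    \sum_(1 <= i < n.+1) (s i <= s n) = \sum_(1 <= i < n.+1) (t i <= t n)) ->
  forall i j, 0 < i -> i < j -> j <= L -> (s i <= s j) = (t i <= t j).
Proof.
move=> eR i j; elim/ltn_ind: j i => j IH i i0 ij jL.
have cmp k l : 0 < k < j -> 0 < l < j -> s k < s l -> t k <= t l.
  move=> /andP[k0 kj] /andP[l0 lj] skl.
  have [kl|lk|kl] := ltngtP k l; last by rewrite kl.
  - by rewrite -(IH l)// ?(ltnW skl)// (leq_trans (ltnW lj)).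
  - have := IH k kj l l0 lk (leq_trans (ltnW kj) jL).
    by rewrite leqNgt skl /= => /esym/negbT; rewrite -ltnNge => /ltnW.
have := eR j; rewrite jL (leq_trans _ ij)// => /(_ isT).
(* The index [j] itself counts 1 on both sides; without it the ranks count earlier indices only. *)
rewrite !(@big_nat_recr _ _ _ j 1)/= ?leqnn ?(leq_trans _ ij)// => /addIn.
rewrite /index_iota; set r := iota _ _ => e.
have inr k : (k \in r) = (0 < k < j).
  by rewrite mem_iota subnKC // (leq_trans _ ij).
have ir : i \in r by rewrite inr i0.
have [ab|] := boolP (all (fun k => (s k <= s j) ==> (t k <= t j)) r).
  by apply: (eq_sum_bool_sub _ e) => // k kr; move/allP: ab => /(_ k kr) /implyP.
(* A [k] below [j] for [s] but not for [t] forces the reverse inclusion: an [l] with [t l <= t j]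
   and [s k < s l] would give [t k <= t l <= t j]. *)
move=> /allPn[k kr]; rewrite negb_imply => /andP[skj tkj].
apply/esym/(eq_sum_bool_sub _ (esym e)) => // l lr tlj.
have [slk|skl] := leqP (s l) (s k); first exact: leq_trans skj.
by move: tkj; rewrite (leq_trans _ tlj)// cmp// -inr.
Qed.

(* Both words become nondecreasing under the same permutation, so they are
   determined by their symbol counts. *)
Lemma order_count_eq s t L :
  (forall i j, 0 < i -> i < j -> j <= L -> (s i <= s j) = (t i <= t j)) ->
  perm_eq (map s (iota 1 L)) (map t (iota 1 L)) ->
  {in iota 1 L, s =1 t}.
Proof.
move=> est; set r := iota 1 L => pst.
(* Ties are broken by index, so [le_s] consults only comparisons [s i <= s j] of an earlier index
   with a later one, which [est] transfers to [t]. *)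
pose le_s i j := if i <= j then s i <= s j else ~~ (s j <= s i).
have tot : total le_s.
  move=> i j; rewrite /le_s; case: (ltngtP i j) => [_|_|->]; last by rewrite leqnn.
  - by case: (s i <= s j).
  - by case: (s j <= s i).
have inr i : (i \in r) = (0 < i <= L) by rewrite mem_iota add1n ltnS.
have le_ss i j : le_s i j -> s i <= s j.
  by rewrite /le_s; case: ifP => // _; rewrite -ltnNge => /ltnW.
have le_st : {in r &, forall i j, le_s i j -> t i <= t j}.
  move=> i j; rewrite !inr => /andP[i0 iL] /andP[j0 jL]; rewrite /le_s.
  case: (ltngtP i j) => [ij|ji|->//]; first by rewrite (est i j).
  by rewrite (est j i)// -ltnNge => /ltnW.
pose r' := sort le_s r.
have sr' : sorted le_s r' by exact: sort_sorted.
have rr' : r' =i r by move=> i; rewrite mem_sort.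
have ss : sorted leq (map s r') by rewrite sorted_map; exact: sub_sorted sr'.
have st : sorted leq (map t r').
  rewrite sorted_map; apply: (sub_in_sorted _ (allss r') sr') => i j ir jr.
  by apply: le_st; rewrite -rr'.
have e : map s r' = map t r'.
  have pu (u : nat -> nat) : perm_eq (map u r') (map u r) by rewrite perm_map// perm_sort.
  apply: (sorted_eq leq_trans anti_leq ss st).
  by rewrite (perm_trans (pu s))// (perm_trans pst)// perm_sym.
by move=> i; rewrite -rr'; move: i; apply/eq_in_map.
Qed.

End Ranks.

(** * Subadditive sequences and logarithmic growth *)

Section Fekete.
Context {R : realType}.

(** The limit is the infimum over positive indices: cut [n] into blocks of a length [N.+1] that
    nearly attains it, plus a remainder whose cost is bounded independently of [n]. *)
Lemma fekete (a : nat -> R) : (forall n, 0 <= a n) ->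
  (forall m n, a (m + n)%N <= a m + a n) ->
  cvgn (fun n => a n / n%:R).
Proof.
move=> a0 aD.
(* Index 0 is left out: [a 0 / 0] is 0 and would make the infimum 0. *)
pose E := [set a n.+1 / n.+1%:R | n in [set: nat]].
have hE : has_inf E.
  split; first by exists (a 1%N / 1), 0%N.
  by exists 0 => _ [n _ <-]; rewrite divr_ge0.
have infE n : (0 < n)%N -> inf E <= a n / n%:R.
  by move: n => [//|n] _; apply: ge_inf; [exact: hE.2|exists n].
apply/cvg_ex; exists (inf E).
suff H (e : R) : 0 < e -> \forall n \near \oo, `|inf E - a n / n%:R| < e.
  by apply/cvgrPdist_lt.
move=> e0.
have e20 : 0 < e / 2 by rewrite divr_gt0.
have [_ [N _ <-] hN] := inf_adherent e20 hE.
have aM q r : a (q * N.+1 + r)%N <= q%:R * a N.+1 + a r.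
  elim: q => [|q IH]; first by rewrite mul0r add0r.
  rewrite mulSn -addnA (le_trans (aD _ _))// -natr1 mulrDl mul1r.
  by rewrite addrAC [leRHS]addrC lerD2l.
pose M := \sum_(r < N.+1) a r.
have M0 : 0 <= M by apply: sumr_ge0.
have : \forall n \near \oo, M / (e / 2) < n%:R by exact: nbhs_infty_gtr.
apply: filter_app; near=> n => Mn.
have n0 : (0 < n)%N by near: n; exists 1%N.
have n0' : 0 < n%:R :> R by rewrite ltr0n.
rewrite distrC ger0_norm ?subr_ge0 ?infE// ltrBlDl.
have qM : (n %/ N.+1)%:R * N.+1%:R <= n%:R :> R.
  by rewrite -natrM ler_nat leq_divM.
have an : a n <= n%:R * (a N.+1 / N.+1%:R) + M.
  rewrite {1}(divn_eq n N.+1) (le_trans (aM _ _))// lerD//.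
    by rewrite [leRHS]mulrA [leRHS]mulrAC ler_wpM2r// ler_pdivlMr.
  have rN : (n %% N.+1 < N.+1)%N by rewrite ltn_mod.
  rewrite /M (bigD1 (Ordinal rN))//= lerDl; exact: sumr_ge0.
rewrite ltr_pdivrMr// (le_lt_trans an)//.
rewrite ltr_pdivrMr// in Mn.
have : n%:R * (a N.+1 / N.+1%:R) <= n%:R * (inf E + e / 2).
  by rewrite ler_pM2l// ltW.
move=> h; apply: (lt_le_trans (ler_ltD h Mn)).
by rewrite -mulrDr mulrC ler_pM2r//; lra.
Unshelve. all: by end_near. Qed.

Lemma ln_div_nat_cvg0 : (fun n : nat => ln (n.+1%:R : R) / (n%:R - 1)) @ \oo --> (0 : R).
Proof.
suff H (e : R) : 0 < e -> \forall n \near \oo, `|0 - ln (n.+1%:R : R) / (n%:R - 1)| < e.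
  by apply/cvgrPdist_lt.
move=> e0.
(* With [y = n - 1], the bound used is [ln (n + 1) <= 2 * sqrt (4 * y) = 4 * sqrt y], which is below
   [e * y] as soon as [16 < e ^+ 2 * y]; the 3 covers the shift and [n + 1 <= 2 * y]. *)
have : \forall n \near \oo, (16 / e ^+ 2 + 3 : R) < n%:R by exact: nbhs_infty_gtr.
apply: filter_app; near=> n => hn.
have ee : 0 < 16 / e ^+ 2 by rewrite divr_gt0// exprn_gt0.
have n3 : 3 < n%:R :> R by lra.
set y := n%:R - 1 : R; have y0 : 0 < y by rewrite /y; lra.
have s0 : 0 < Num.sqrt y by rewrite sqrtr_gt0.
have n1 : n.+1%:R <= 2 * y :> R by rewrite /y -natr1; lra.
rewrite sub0r normrN ger0_norm; last by rewrite divr_ge0 ?(ltW y0)// ln_ge0// ler1n.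
rewrite ltr_pdivrMr//.
have h1 : ln (n.+1%:R : R) <= 2 * Num.sqrt (4 * y).
  apply: le_trans (ln_le_sqrt _) _; rewrite ?ltr0n// ler_pM2l// ler_wsqrtr//; lra.
have h2 : Num.sqrt (4 * y) = 2 * Num.sqrt y.
  by rewrite sqrtrM// (_ : 4 = 2 ^+ 2) ?sqrtr_sqr ?ger0_norm//; ring.
apply: (le_lt_trans h1); rewrite h2 -{2}(sqr_sqrtr (ltW y0)) expr2 !mulrA ltr_pM2r//.
have : 16 < e ^+ 2 * y.
  by rewrite mulrC -ltr_pdivrMr ?exprn_gt0// /y; lra.
rewrite -{1}(sqr_sqrtr (ltW y0)) -exprMn => h.
rewrite ltNge; apply/negP => h'; move: h; apply/negP; rewrite -leNgt.
have es : 0 <= e * Num.sqrt y by rewrite mulr_ge0 ?ltW.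
by rewrite (_ : 16 = (2 * 2) ^+ 2); [rewrite lerXn2r ?nnegrE; lra|ring].
Unshelve. all: by end_near. Qed.

End Fekete.

(** * Entropy rates of stationary processes *)

Lemma cvg_near_eq {R : realType} (u v : nat -> R) (l : R) :
  (\forall n \near \oo, u n = v n) -> u @ \oo --> l -> v @ \oo --> l.
Proof. by move=> uv; apply: cvg_trans; exact: near_eq_cvg. Qed.

Section Process.
Context {disp : measure_display} {T : measurableType disp} {R : realType}.
Variables (mu : probability T R) (D : set T) (f : T -> T).
Hypotheses (mD : measurable D) (D1 : mu D = 1%E).
Hypothesis fD : forall x, D x -> D (f x).
Hypothesis mf : measurable_fun D f.
Hypothesis f_inv : forall A, measurable A -> A `<=` D ->
  mu (D `&` f @^-1` A) = mu A.

Local Notation rv := (rv D).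
Local Notation entropy := (entropy mu D).

Lemma iterD_in n x : D x -> D (iter n f x).
Proof. by move=> Dx; elim: n => //= n; exact: fD. Qed.

Lemma preimage_setI (A : set T) :
  D `&` f @^-1` (D `&` A) = D `&` [set x | A (f x)].
Proof.
by apply/seteqP; split=> x /=;
  [move=> [Dx []]|move=> [Dx ?]; split=> //; split=> //; exact: fD].
Qed.

Lemma rv_comp (A : finType) (X : T -> A) : rv X -> rv (fun x => X (f x)).
Proof.
by move=> mX a; rewrite -(preimage_setI [set x | X x = a]); exact: (mf mD (mX a)).
Qed.

Lemma entropy_comp (A : finType) (X : T -> A) : rv X ->
  entropy (fun x => X (f x)) = entropy X.
Proof.
move=> mX; apply: eq_bigr => a _; congr ent_term; congr fine.
by rewrite -(preimage_setI [set x | X x = a]) f_inv//; move=> x [].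
Qed.

Lemma rv_iter (A : finType) (X : T -> A) n : rv X -> rv (fun x => X (iter n f x)).
Proof.
move=> mX; elim: n => [//|n IH].
have -> : (fun x => X (iter n.+1 f x)) = (fun x => X (iter n f (f x))).
  by apply/funext => x; rewrite iterSr.
exact: (rv_comp IH).
Qed.

Lemma entropy_iter (A : finType) (X : T -> A) n : rv X ->
  entropy (fun x => X (iter n f x)) = entropy X.
Proof.
move=> mX; elim: n => [//|n IH]; rewrite -[RHS]IH -(entropy_comp (rv_iter n mX)).
by congr (entropy _); apply/funext => x; rewrite iterSr.
Qed.

Definition word (A : finType) (X : T -> A) (L : nat) (x : T) : {ffun 'I_L -> A} :=
  [ffun i : 'I_L => X (iter i f x)].

Lemma rv_word (A : finType) (X : T -> A) L : rv X -> rv (word X L).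
Proof. by move=> mX; apply: rv_ffun => // i; exact: rv_iter. Qed.

Lemma word_eq (A : finType) (X : T -> A) L x y :
  word X L x = word X L y <->
  forall i, (i < L)%N -> X (iter i f x) = X (iter i f y).
Proof.
split=> [/ffunP e i iL|e]; first by have := e (Ordinal iL); rewrite !ffunE.
by apply/ffunP => i; rewrite !ffunE; exact: e.
Qed.

(** The last [n] letters form the word read from [iter m f x], which has the entropy of [word X n]
    by invariance. *)
Lemma entropy_word_subadditive (A : finType) (X : T -> A) m n : rv X ->
  entropy (word X (m + n)) <= entropy (word X m) + entropy (word X n).
Proof.
move=> mX; have mW k : rv (word X k) := rv_word mX; have mWn := rv_iter m (mW n).
rewrite -(entropy_iter m (mW n)).
apply: le_trans (entropy_pair_le _ D1 _ _) => //.
apply: entropy_le_determined => //; first exact: rv_pair.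
move=> x y _ _ [/word_eq em /word_eq en]; apply/word_eq => i imn.
have [im|mi] := ltnP i m; first exact: em.
by have := en (i - m)%N; rewrite -!iterD subnK//; apply; rewrite ltn_subLR.
Qed.

Definition entropy_rate (A : finType) (X : T -> A) : R :=
  limn (fun L => entropy (word X L) / L%:R).

Lemma cvg_entropy_rate (A : finType) (X : T -> A) : rv X ->
  (fun L => entropy (word X L) / L%:R) @ \oo --> entropy_rate X.
Proof.
move=> mX; apply: (@fekete R (fun L => entropy (word X L))) => [n|m n].
  by apply: entropy_ge0 => //; exact: rv_word.
exact: entropy_word_subadditive.
Qed.

(** Chain rule, one letter at a time: given all other letters, the new letter of [X] is at most as
    uncertain as given the simultaneous letter of [Y] alone, and by invariance that cost is the same
    at every time. *)
Lemma entropy_word_cond (A B : finType) (X : T -> A) (Y : T -> B) L :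
  rv X -> rv Y ->
  entropy (fun x => (word X L x, word Y L x)) - entropy (word Y L) <=
  L%:R * (entropy (fun x => (X x, Y x)) - entropy Y).
Proof.
move=> mX mY; elim: L => [|L IH].
  rewrite mul0r subr_le0 entropy_le_determined//; first exact: rv_word.
  by move=> x y _ _ e; congr pair => //; apply/ffunP => -[].
set c := entropy (fun x => (X x, Y x)) - entropy Y in IH *.
set U := word X L in IH; set V := word Y L in IH.
pose a x := X (iter L f x); pose b x := Y (iter L f x).
have [mU mV] : rv U /\ rv V by split; exact: rv_word.
have [ma mb] : rv a /\ rv b by split; exact: rv_iter.
have mVb := rv_pair mV mb.
have snoc (C : finType) (Z : T -> C) x y :
    word Z L.+1 x = word Z L.+1 y <->
    word Z L x = word Z L y /\ Z (iter L f x) = Z (iter L f y).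
  rewrite !word_eq; split=> [e|[e eL] i]; last first.
    by rewrite ltnS leq_eqVlt => /predU1P[->//|]; exact: e.
  by split=> [i iL|]; apply: e => //; exact: ltnW.
have -> : entropy (word Y L.+1) = entropy (fun x => (V x, b x)).
  apply: entropy_eq_determined => // x y _ _.
    by move=> [? ?]; apply/snoc.
  by move=> /snoc[e1 e2]; congr pair.
have -> : entropy (fun x => (word X L.+1 x, word Y L.+1 x)) =
    entropy (fun x => (a x, (U x, (V x, b x)))).
  apply: entropy_eq_determined => [|x y _ _|x y _ _].
  - by do 2![apply: rv_pair => //].
  - by move=> [? ? ? ?]; congr pair; apply/snoc.
  - by move=> [/snoc[e1 e2] /snoc[e3 e4]]; do 3?congr pair.
have h1 : entropy (fun x => (a x, (U x, (V x, b x))))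
    - entropy (fun x => (U x, (V x, b x))) <= entropy (fun x => (a x, b x)) - entropy b.
  by apply: condentropy_le => //; [exact: rv_pair|move=> x y _ _ []].
(* Knowing the new letter [b] as well cannot increase the uncertainty of the past [U] given [V]. *)
have h2 : entropy (fun x => (U x, (V x, b x))) - entropy (fun x => (V x, b x)) <=
    entropy (fun x => (U x, V x)) - entropy V.
  by apply: condentropy_le => //; move=> x y _ _ [].
have h3 : entropy (fun x => (a x, b x)) - entropy b = c.
  by rewrite /c -(entropy_iter L mY) -(entropy_iter L (rv_pair mX mY)).
by rewrite -natr1 mulrDl mul1r; lra.
Qed.

Lemma entropy_rate_le (A B : finType) (X : T -> A) (Y : T -> B) :
  rv X -> rv Y ->
  entropy_rate X <= entropy_rate Y + (entropy (fun x => (X x, Y x)) - entropy Y).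
Proof.
move=> mX mY; set c := entropy _ - _.
have cX := cvg_entropy_rate mX.
have cY : (fun L => entropy (word Y L) / L%:R + c) @ \oo --> entropy_rate Y + c.
  by apply: cvgD; [exact: cvg_entropy_rate|exact: cvg_cst].
rewrite -(cvg_lim (@Rhausdorff R) cX) -(cvg_lim (@Rhausdorff R) cY).
apply: ler_lim; [by apply/cvg_ex; exists (entropy_rate X)|by apply/cvg_ex; exists (entropy_rate Y + c)|].
near=> L.
have L0 : 0 < L%:R :> R by rewrite ltr0n; near: L; exists 1%N.
rewrite ler_pdivrMr// mulrDl divfK ?gt_eqF//.
have := entropy_word_cond L mX mY; rewrite -/c => h.
have : entropy (word X L) <= entropy (fun x => (word X L x, word Y L x)).
  by apply: entropy_le_determined => [|x y _ _ []//]; apply: rv_pair; exact: rv_word.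
by lra.
Unshelve. all: by end_near. Qed.

End Process.

(** * Rank entropy against block entropy *)

Section RankWords.
Context {R : realType} {d : nat}.
Local Notation T := (Rd R d).
Variables (mu : probability T R) (D : set T) (f : T -> T).
Hypotheses (mD : measurable D) (D1 : mu D = 1%E).
Hypothesis fD : forall x, D x -> D (f x).
Hypothesis mf : measurable_fun D f.
Hypothesis f_inv : forall A, measurable A -> A `<=` D ->
  mu (D `&` f @^-1` A) = mu A.

Variables (M : nat) (X : T -> 'I_M).
Hypothesis mX : rv D X.
Let S (n : nat) (x : T) : nat := X (iter n f x).

Lemma rank_word_eq L x y : rank_word S L x = rank_word S L y ->
  forall n, (0 < n <= L)%N -> rank_var S n x = rank_var S n y.
Proof.
move=> /ffunP e [//|n] /andP[_ nL].
have := e (Ordinal nL); rewrite !ffunE => /(congr1 val) /=.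
(* [inord] keeps only values up to [L]; a rank at time at most [L] is in range, so nothing is
   lost. *)
have le z : (rank_var S n.+1 z < L.+1)%N.
  rewrite ltnS (leq_trans _ nL)// /rank_var.
  apply: (@leq_trans (\sum_(1 <= i < n.+2) 1)).
    by apply: leq_sum => i _; exact: leq_b1.
  by rewrite sum_nat_const_nat subn1 muln1.
by rewrite !inordK.
Qed.

(** Ranks are taken over times 1 to [L], so the matching block starts at [f x]; invariance removes
    this shift from the entropies. *)
Lemma rank_word_determined L :
  determined D (rank_word S L) (fun x => word f X L (f x)).
Proof.
move=> x y _ _ /word_eq e; apply/ffunP => m; rewrite !ffunE; congr inord.
have eS i : (0 < i <= m.+1)%N -> S i x = S i y.
  move=> /andP[i0 im]; rewrite /S -(prednK i0) !iterSr e//.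
  by rewrite (leq_trans _ (ltn_ord m))// prednK.
rewrite /rank_var big_nat [RHS]big_nat; apply: eq_bigr => i im.
by rewrite !eS// leqnn.
Qed.

Lemma word_determined_rank L :
  determined D (fun x => word f X L (f x))
    (fun x => (rank_word S L x,
       [ffun v : 'I_M => inord (count_mem (v : nat) [seq S i x | i <- iota 1 L]) : 'I_L.+1])).
Proof.
move=> x y _ _ [/rank_word_eq eR /ffunP eC].
have e : {in iota 1 L, (S^~ x) =1 (S^~ y)}.
  apply: order_count_eq; first exact: rank_order.
  (* Passing through ['I_M] reduces the permutation to the counts of the symbols below [M], the only
     ones recorded. *)
  have cS z : perm_eq [seq S i z | i <- iota 1 L]
     [seq val v | v <- [seq X (iter i f z) | i <- iota 1 L]].
    by rewrite -map_comp.
  rewrite (perm_trans (cS x))// perm_sym (perm_trans (cS y))// perm_map//.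
  rewrite perm_sym /perm_eq; apply/allP => v _ /=.
  have := eC v; rewrite !ffunE => /(congr1 val).
  have cv z : count_mem (v : nat) [seq S i z | i <- iota 1 L] =
      count_mem v [seq X (iter i f z) | i <- iota 1 L].
    by rewrite !count_map; apply: eq_count => i /=.
  have cL z : (count_mem (v : nat) [seq S i z | i <- iota 1 L] < L.+1)%N.
    by rewrite ltnS (leq_trans (count_size _ _))// size_map size_iota.
  by rewrite /= !inordK// !cv => ->.
apply/word_eq => i iL; rewrite -!iterSr; apply/val_inj.
by apply: (e i.+1); rewrite mem_iota.
Qed.

Lemma cvg_rank_block_entropy :
  (fun L : nat => rank_block_entropy mu D S L / (L%:R - 1)) @ \oo
    --> entropy_rate mu D f X.
Proof.
pose H L := entropy mu D (word f X L).
have mW L : rv D (word f X L) by exact: rv_word.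
have mW' L := rv_comp mD fD mf (mW L).
have up L : rank_block_entropy mu D S L <= H L.
  rewrite /H -(entropy_comp fD f_inv (mW L)).
  by apply: entropy_le_determined => //; exact: rank_word_determined.
(* The count vector is a map from [M] symbols to [L + 1] values, so its entropy is at most
   [M * ln (L + 1) / ln 2]. *)
pose c : R := M%:R / ln 2.
have low L : H L - c * ln L.+1%:R <= rank_block_entropy mu D S L.
  rewrite lerBlDr /H -(entropy_comp fD f_inv (mW L)).
  have mR := rv_determined (mW' L) (@rank_word_determined L).
  set C := fun x => [ffun v : 'I_M => inord (count_mem (v : nat) [seq S i x | i <- iota 1 L]) : 'I_L.+1].
  have mC : rv D C.
    apply: (rv_determined (mW' L)) => x y _ _ /word_eq e.
    apply/ffunP => v; rewrite !ffunE; congr (inord (count_mem _ _)).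
    apply/eq_in_map => i; rewrite mem_iota add1n ltnS => /andP[i0 iL].
    by rewrite /S -(prednK i0) !iterSr e// prednK.
  apply: (@le_trans _ _ (entropy mu D (fun x => (rank_word S L x, C x)))).
    apply: entropy_le_determined; first exact: rv_pair.
    exact: word_determined_rank.
  apply: (le_trans (entropy_pair_le mD D1 mR mC)).
  rewrite lerD2l (le_trans (entropy_le_card mD D1 mC))//.
  rewrite card_ffun !card_ord natrX lnXn ?ltr0n// /c.
  by rewrite -[ln _ *+ _]mulr_natl mulrAC.
have cH : (fun L : nat => H L / (L%:R - 1)) @ \oo --> entropy_rate mu D f X.
  have h1 : (fun L : nat => (L%:R : R) / (L%:R - 1)) @ \oo --> (1 : R).
    (* Rank entropy is normalised by [L - 1], block entropy by [L]. Shifted by 2, the ratio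
       [L / (L - 1)] becomes [1 + 1 / (n + 1)], with no zero denominator. *)
    rewrite -(cvg_shiftn 2).
    have h : (fun n => 1 + harmonic n) @ \oo --> (1 + 0 : R).
      by apply: cvgD; [exact: cvg_cst|exact: cvg_harmonic].
    rewrite addr0 in h; apply: cvg_near_eq h; near=> n; rewrite /= /harmonic.
    have n0 : n.+1%:R != 0 :> R by rewrite pnatr_eq0.
    rewrite addn2 -[n.+2%:R]natr1 addrK mulrDl mul1r divff//.
  have h : (fun L : nat => H L / L%:R * (L%:R / (L%:R - 1))) @ \oo
      --> entropy_rate mu D f X * 1.
    by apply: cvgM => //; exact: cvg_entropy_rate.
  rewrite mulr1 in h; apply: cvg_near_eq h; near=> L.
  have L0 : L%:R != 0 :> R by rewrite pnatr_eq0 -lt0n; near: L; exists 1%N.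
  by rewrite /= mulrA divfK.
have cL : (fun L : nat => H L / (L%:R - 1) - c * (ln L.+1%:R / (L%:R - 1))) @ \oo
    --> entropy_rate mu D f X.
  rewrite -[X in _ --> X]subr0 -(mulr0 c); apply: cvgB => //.
  by apply: cvgM; [exact: cvg_cst|exact: ln_div_nat_cvg0].
apply: squeeze_cvgr cL cH; near=> L.
have L1 : 0 < (L%:R - 1)^-1 :> R.
  by rewrite invr_gt0 subr_gt0 ltr1n; near: L; exists 2%N.
by rewrite mulrA -mulrBl !ler_pM2r// low up.
Unshelve. all: by end_near. Qed.

End RankWords.

(** * Product partitions *)

Section Partitions.

(** Mixed-radix digits are unique: in Horner form the last digit is the residue modulo its radix,
    and the remaining digits follow by induction on the quotient. *)
Lemma mixed_radix_inj n (N c c' : 'I_n -> nat) :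
  (forall k, c k < N k)%N -> (forall k, c' k < N k)%N ->
  (\sum_(k < n) c k * \prod_(k' < n | (k < k')%N) N k')%N =
  (\sum_(k < n) c' k * \prod_(k' < n | (k < k')%N) N k')%N -> c =1 c'.
Proof.
elim: n N c c' => [|n IH] N c c' cN c'N; first by move=> _ [].
have horner (b : 'I_n.+1 -> nat) :
    (\sum_(k < n.+1) b k * \prod_(k' < n.+1 | (k < k')%N) N k')%N =
    ((\sum_(k < n) b (widen_ord (leqnSn n) k) *
       \prod_(k' < n | (k < k')%N) N (widen_ord (leqnSn n) k')) * N ord_max
     + b ord_max)%N.
  rewrite big_ord_recr/= [X in (_ + _ * X)%N]big_pred0 ?muln1; last first.
    by move=> k; apply/negbTE; rewrite -leqNgt -ltnS ltn_ord.
  congr addn; rewrite big_distrl/=; apply: eq_bigr => k _.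
  by rewrite big_mkcond big_ord_recr/= -big_mkcond/= ltn_ord mulnA.
rewrite !horner => e.
have N0 : (0 < N ord_max)%N by rewrite (leq_ltn_trans _ (cN ord_max)).
have elast : c ord_max = c' ord_max.
  by move/(congr1 (modn^~ (N ord_max))): e; rewrite !modnMDl !modn_small.
have einit := IH (fun k => N (widen_ord (leqnSn n) k)) _ _
  (fun k => cN (widen_ord (leqnSn n) k)) (fun k => c'N (widen_ord (leqnSn n) k)).
move=> k; have [kn|] := ltnP k n.
  rewrite (_ : k = widen_ord (leqnSn n) (Ordinal kn)); last exact/val_inj.
  apply: einit; apply/eqP; rewrite -(eqn_pmul2r N0); apply/eqP.
  by move: e; rewrite elast => /addIn.
move=> nk; rewrite (_ : k = ord_max)//; apply/val_inj/eqP => /=.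
by rewrite eqn_leq nk -ltnS ltn_ord.
Qed.

Context {R : realType} {d : nat}.
Local Notation T := (Rd R d).

Lemma measurable_coord (k : 'I_d) (i : interval R) :
  measurable [set x : T | (x : 'rV[R]_d) ord0 k \in i].
Proof.
have mc : measurable_fun setT (fun x : T => (x : 'rV[R]_d) ord0 k).
  apply: (measurability _ (measurable_realfun.RGenOpens.measurableE R)) => _ [_ [a [b ->] <-]].
  apply: measurableI => //; apply: sub_sigma_algebra.
  by apply: open_comp => [x _|]; [exact: coord_continuous|exact: interval_open].
by have := mc measurableT _ (measurable_itv i); rewrite setTI.
Qed.

Variable Ik : 'I_d -> interval R.
Hypothesis Ikb : forall k, bounded_itv (Ik k).
Local Notation D := (box Ik : set T).

Lemma measurable_box : measurable D.
Proof.
rewrite (_ : D = \bigcap_(k in [set: 'I_d]) [set x : T | (x : 'rV[R]_d) ord0 k \in Ik k]).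
  by apply: fin_bigcap_measurable => // k _; exact: measurable_coord.
by apply/seteqP; split=> x /= h k => [_|]; exact: h.
Qed.

Variable iota : prod_partition Ik.

Lemma coord_cellP (k : 'I_d) (x : T) : D x ->
  exists2 j : 'I_(pp_N iota k), coord_cell iota k x = j &
    (x : 'rV[R]_d) ord0 k \in pp_J j.
Proof.
move=> /(_ k); rewrite (pp_cover iota) => /existsP[j xj].
rewrite /coord_cell; case: pickP => [i xi|/(_ j)]; last by rewrite xj.
by exists i.
Qed.

Lemma pp_J_inj (k : 'I_d) (i j : 'I_(pp_N iota k)) (x : R) :
  x \in pp_J i -> x \in pp_J j -> i = j.
Proof.
move=> xi xj; apply/val_inj/eqP; rewrite eqn_leq.
by apply/andP; split; rewrite leqNgt; apply/negP => h;
  [have := pp_order h xj xi|have := pp_order h xi xj]; rewrite ltxx.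
Qed.

(** [itv_length] is 0 on unbounded intervals, so the norm controls a factor only once that factor is
    known to be bounded; it is, lying inside a bounded side of the box. *)
Lemma pp_J_length (k : 'I_d) (j : 'I_(pp_N iota k)) (x y : R) :
  x \in pp_J j -> y \in pp_J j -> y - x <= pp_norm iota.
Proof.
move=> xj yj.
have J_Ik z : z \in pp_J j -> z \in Ik k.
  by move=> zj; rewrite (pp_cover iota); apply/existsP; exists j.
apply: (@le_trans _ _ (itv_length (pp_J j))); last first.
  apply: le_trans (le_bigmax _ _ k).
  exact: (le_bigmax _ (fun j => itv_length (pp_J j)) j).
(* A factor unbounded to the right would contain [Num.max x b + 1], which is right of its point [x]
   but beyond the end [b] of the side. *)
have J_ub (l : itv_bound R) : pp_J j = Interval l +oo%O -> False.
  move: (Ikb k) J_Ik xj; case: (Ik k) => -[ba a|//] [bb b|//] _ J_Ik + e.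
  rewrite !e in J_Ik *; rewrite itv_boundlr => /andP[lx _].
  have xz : x < Num.max x b + 1 by rewrite ltr_pwDr// le_max lexx.
  have bz : b < Num.max x b + 1 by rewrite ltr_pwDr// le_max lexx orbT.
  have /J_Ik : Num.max x b + 1 \in Interval l +oo%O.
    by rewrite itv_boundlr (le_trans lx)//= bnd_simp ltW.
  rewrite in_itv/= => /andP[_ zb].
  have : Num.max x b + 1 <= b by move: zb; case: (bb) => //= /ltW.
  by lra.
have J_lb (r : itv_bound R) : pp_J j = Interval -oo%O r -> False.
  move: (Ikb k) J_Ik xj; case: (Ik k) => -[ba a|//] [bb b|//] _ J_Ik + e.
  rewrite !e in J_Ik *; rewrite itv_boundlr => /andP[_ xr].
  have xz : Num.min x a - 1 < x by rewrite ltrBlDr ltr_pwDr// ge_min lexx.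
  have az : Num.min x a - 1 < a by rewrite ltrBlDr ltr_pwDr// ge_min lexx orbT.
  have /J_Ik : Num.min x a - 1 \in Interval -oo%O r.
    by rewrite itv_boundlr/=; apply: le_trans xr; rewrite bnd_simp ltW.
  rewrite in_itv/= => /andP[az' _].
  have : a <= Num.min x a - 1 by move: az'; case: (ba) => //= /ltW.
  by lra.
move: xj yj J_ub J_lb; case: (pp_J j) => -[la u|[|]] [lb v|[|]] => xj yj ub lb' /=;
  try by [case: (ub _ erefl)|case: (lb' _ erefl)|move: xj; rewrite itv_boundlr ?andbF].
move: xj yj; rewrite !in_itv/= => /andP[xu _] /andP[_ vy].
have {}xu : u <= x by move: xu; case: (la) => //= /ltW.
have {}vy : y <= v by move: vy; case: (lb) => //= /ltW.
by lra.
Qed.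

Lemma cell_index_inj (x y : T) : D x -> D y ->
  cell_index iota x = cell_index iota y ->
  forall k, coord_cell iota k x = coord_cell iota k y.
Proof.
move=> Dx Dy [] e.
have lt z : D z -> forall k, (coord_cell iota k z < pp_N iota k)%N.
  by move=> Dz k; have [j -> _] := coord_cellP k Dz.
exact: (mixed_radix_inj (lt x Dx) (lt y Dy) e).
Qed.

Lemma cell_ball (x y : T) (e : R) : D x -> D y -> pp_norm iota < e ->
  cell_index iota x = cell_index iota y ->
  ball (x : 'rV[R]_d) e (y : 'rV[R]_d).
Proof.
move=> Dx Dy lt_e /(cell_index_inj Dx Dy) exy.
have e0 : 0 < e.
  by apply: le_lt_trans lt_e; rewrite /pp_norm; exact: bigmax_ge_id.
split=> // i k; rewrite (ord1 i) /ball/=.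
have [j jx xj] := coord_cellP k Dx; have [j' jy yj] := coord_cellP k Dy.
have ej : j = j' by apply/val_inj; rewrite /= -jx -jy.
rewrite -{}ej in yj; rewrite (le_lt_trans _ lt_e)// ler_norml.
have := pp_J_length xj yj; have := pp_J_length yj xj; lra.
Qed.

(** A generous alphabet size, valid at every point: each digit is bounded by [pp_N] itself, which
    also covers the default 0 of [coord_cell]. One successor is the enumeration from 1, the other
    makes the bound strict. Symbols that never occur add no entropy. *)
Definition cell_bound : nat :=
  (\sum_(k < d) pp_N iota k * \prod_(k' < d | (k < k')%N) pp_N iota k').+2.

Lemma cell_index_lt (x : T) : (cell_index iota x < cell_bound)%N.
Proof.
rewrite !ltnS; apply: leq_sum => k _; rewrite leq_mul2r; apply/orP; right.
by rewrite /coord_cell; case: pickP => // j _; rewrite ltnW.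
Qed.

Definition cell_sym (x : T) : 'I_cell_bound := Ordinal (cell_index_lt x).

Lemma rv_cell_sym : rv D cell_sym.
Proof.
(* A common bound gives all coordinate cells one finite type, as [rv_ffun] requires. *)
pose B := (\max_(k < d) pp_N iota k)%N.
have cB k x : (coord_cell iota k x < B.+1)%N.
  rewrite ltnS (leq_trans _ (leq_bigmax k))// /coord_cell.
  by case: pickP => // j _; rewrite ltnW.
pose C k x : 'I_B.+1 := Ordinal (cB k x).
have mC k : rv D (C k).
  move=> b; have [bN|bN] := ltnP b (pp_N iota k); last first.
    rewrite (_ : _ `&` _ = set0)//; apply/seteqP; split=> x //= [Dx /(congr1 val)/=].
    have [j -> _ jb] := coord_cellP k Dx.
    by move: bN; rewrite -jb leqNgt ltn_ord.
  rewrite (_ : _ `&` _ = D `&`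
      [set x : T | (x : 'rV[R]_d) ord0 k \in pp_J (Ordinal bN)]).
    by apply: measurableI; [exact: measurable_box|exact: measurable_coord].
  apply/seteqP; split=> x /= [Dx h]; split=> //; have [j ej xj] := coord_cellP k Dx.
    move/(congr1 val): h => /=; rewrite ej => jb.
    by rewrite (_ : Ordinal bN = j)//; apply/val_inj.
  by apply/val_inj => /=; rewrite ej (pp_J_inj xj h).
apply: (rv_determined (rv_ffun measurable_box mC)) => x y _ _ /ffunP e.
apply/val_inj; rewrite /= /cell_index; congr S; apply: eq_bigr => k _.
by have := e k; rewrite !ffunE => /(congr1 val)/= ->.
Qed.

End Partitions.

Arguments rv_cell_sym {R d Ik} iota.

(** * Approximation of measurable sets by cells *)

Section Approximation.
Context {R : realType} {d : nat} (Ik : 'I_d -> interval R).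
Local Notation T := (Rd R d).
Variable mu : probability T R.
Hypothesis Ikb : forall k, bounded_itv (Ik k).
Hypothesis D1 : mu (box Ik) = 1%E.
Local Notation D := (box Ik : set T).
Let mD : measurable D := measurable_box Ik.
Local Notation prob := (prob mu D).

(** Symmetric difference of [A] and the union of the cells numbered by [G]. *)
Definition cell_error (iota : prod_partition Ik) (A : set T) (G : set nat) : set T :=
  [set x | ~ (A x <-> G (cell_index iota x))].

(** The threshold [r] precedes [iota], so it is uniform over all partitions of smaller norm; only
    [G] depends on the partition. *)
Definition cell_approximable (A : set T) : Prop :=
  measurable A /\ forall e : R, 0 < e -> \forall r \near 0^'+,
    forall iota : prod_partition Ik, pp_norm iota < r ->
    exists G : set nat, prob (cell_error iota A G) < e.

Lemma measurable_cell_union (iota : prod_partition Ik) (G : set nat) :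
  measurable (D `&` [set x | G (cell_index iota x)]).
Proof.
apply: (measurable_determined (rv_cell_sym iota)) => x y _ _.
by move=> /(congr1 val) /= ->.
Qed.

Lemma measurable_cell_error (iota : prod_partition Ik) (A : set T) (G : set nat) :
  measurable A -> measurable (D `&` cell_error iota A G).
Proof.
move=> mA; have mG := measurable_cell_union iota G.
rewrite (_ : _ `&` _ =
   ((D `&` A) `\` (D `&` [set x | G (cell_index iota x)])) `|`
   ((D `&` [set x | G (cell_index iota x)]) `\` (D `&` A))).
  have mDA := measurableI _ _ mD mA.
  by apply: measurableU; exact: measurableD.
apply/seteqP; split=> x; rewrite /cell_error /=.
  have [?|?] := pselect (A x); have [?|?] := pselect (G (cell_index iota x)); tauto.
tauto.
Qed.

Lemma cell_approximable0 : cell_approximable set0.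
Proof.
split=> // e e0; near=> r => iota _; exists set0; rewrite prob0//.
by apply/seteqP; split=> x //= [_]; apply.
Unshelve. all: by end_near. Qed.

Lemma cell_approximableC A : cell_approximable A -> cell_approximable (~` A).
Proof.
move=> [mA hA]; split; first exact: measurableC.
move=> e /hA; apply: filter_app; near=> r => h iota /h[G hG].
exists (~` G); rewrite (_ : cell_error _ _ _ = cell_error iota A G)//.
apply/seteqP; split=> x; rewrite /cell_error /=; last tauto.
have [?|?] := pselect (A x); have [?|?] := pselect (G (cell_index iota x)); tauto.
Unshelve. all: by end_near. Qed.

Lemma cell_approximableU A B :
  cell_approximable A -> cell_approximable B -> cell_approximable (A `|` B).
Proof.
move=> [mA hA] [mB hB]; split; first exact: measurableU.
move=> e e0; have e20 : 0 < e / 2 by rewrite divr_gt0.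
move: (hB _ e20); apply: filter_app; move: (hA _ e20); apply: filter_app.
near=> r => hAr hBr iota lt_r.
have [GA hGA] := hAr iota lt_r; have [GB hGB] := hBr iota lt_r.
exists (GA `|` GB).
have mEA := measurable_cell_error iota GA mA.
have mEB := measurable_cell_error iota GB mB.
apply: (@le_lt_trans _ _ (prob (cell_error iota A GA `|` cell_error iota B GB))).
  apply: prob_le.
  - exact: measurable_cell_error (measurableU _ _ mA mB).
  - by rewrite setIUr; exact: measurableU.
  - move=> x [_]; rewrite /cell_error /= => h; apply/not_andP; tauto.
apply: (le_lt_trans (probU mu mEA mEB)); lra.
Unshelve. all: by end_near. Qed.

(** Continuity of the measure from above; it disposes of the tails of countable unions and of the
    boundary layers of open sets. *)
Lemma prob_tail_small (F : nat -> set T) (e : R) :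
  (forall n, measurable (F n)) -> (forall n m, (n <= m)%N -> F m `<=` F n) ->
  (forall x, D x -> ~ forall n, F n x) -> 0 < e ->
  exists n, prob (F n) < e.
Proof.
move=> mF decF F0 e0.
have mDF n : measurable (D `&` F n) by exact: measurableI.
have F00 : \bigcap_n (D `&` F n) = set0.
  apply/seteqP; split=> x //= h; have Dx := (h 0%N Logic.I).1.
  by apply: (F0 x Dx) => n; exact: (h n Logic.I).2.
have : mu \o (fun n => D `&` F n) @ \oo --> mu (\bigcap_n (D `&` F n)).
  apply: nonincreasing_cvg_mu => //.
  - by rewrite (le_lt_trans (probability_le1 mu (mDF _)))// ltry.
  - by rewrite F00.
  - by move=> n m nm; apply/subsetPset => x [Dx Fx]; split=> //; exact: decF Fx.
rewrite F00 measure0 => /fine_cvgP[_] /cvgrPdist_lt /(_ e e0).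
case=> N _ /(_ N (leqnn N)) /=; rewrite sub0r normrN => h.
by exists N; apply: le_lt_trans h; exact: ler_norm.
Qed.

(** A finite partial union misses less than [e / 2] of the whole, and is itself approximated within
    [e / 2]. *)
Lemma cell_approximable_bigcup (A : nat -> set T) :
  (forall n, cell_approximable (A n)) -> cell_approximable (\bigcup_n A n).
Proof.
move=> hA; have mA n : measurable (A n) := (hA n).1.
have mU : measurable (\bigcup_n A n) by exact: bigcupT_measurable.
split=> // e e0; have e20 : 0 < e / 2 by rewrite divr_gt0.
pose B n := \big[setU/set0]_(i < n) A i.
have hB n : cell_approximable (B n).
  rewrite /B; elim: n => [|n IH]; first by rewrite big_ord0; exact: cell_approximable0.
  by rewrite big_ord_recr; exact: cell_approximableU.
have mB n : measurable (B n) := (hB n).1.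
have BE n x : B n x <-> exists2 i, (i < n)%N & A i x.
  by rewrite /B -bigcup_mkord; split=> -[i ? ?]; exists i.
have [n hn] : exists n, prob (\bigcup_n A n `\` B n) < e / 2.
  apply: prob_tail_small => // [n|n m nm x [Ux nBx]|x _ h].
  - exact: measurableD.
  - split=> // /BE[i ni Ax]; apply: nBx; apply/BE; exists i => //.
    exact: leq_trans nm.
  - have [[i _ Ax] _] := h 0%N; have [_] := h i.+1.
    by apply; apply/BE; exists i.
move: ((hB n).2 _ e20); apply: filter_app; near=> r => h iota /h[G hG].
exists G; have mE := measurable_cell_error iota G (mB n).
have mT := measurableI _ _ mD (measurableD mU (mB n)).
apply: (@le_lt_trans _ _ (prob (cell_error iota (B n) G `|` (\bigcup_n A n `\` B n)))).
  apply: prob_le.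
  - exact: measurable_cell_error.
  - by rewrite setIUr; exact: measurableU.
  - move=> x [_]; rewrite /cell_error /= => h'.
    have BU : B n x -> (\bigcup_n A n) x by move=> /BE[i _ Ax]; exists i.
    have [?|?] := pselect (B n x); [left|]; first tauto.
    have [?|?] := pselect ((\bigcup_n A n) x); tauto.
apply: (le_lt_trans (probU mu mE mT)); lra.
Unshelve. all: by end_near. Qed.

(** Keep the cells whose points all lie in [U]. A point of [U] in any other cell shares it with a
    point outside [U], hence lies in a thin layer along the boundary; as [U] is open, these layers
    shrink to nothing. *)
Lemma cell_approximable_open (U : set 'rV[R]_d) :
  open U -> cell_approximable (U : set T).
Proof.
move=> oU; have mU : measurable (U : set T) by exact: sub_sigma_algebra.
split=> // e e0.
pose F n : set T := U `&` \bigcup_(y in ~` U) ball (y : 'rV[R]_d) n.+1%:R^-1.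
have [n hn] : exists n, prob (F n) < e.
  apply: prob_tail_small => // [n|n m nm x [Ux [y nUy bxy]]|x _ h].
  - apply: measurableI => //; apply: sub_sigma_algebra.
    by apply: bigcup_open => y _; exact: ball_open.
  - split=> //; exists y => //; apply: le_ball bxy.
    by rewrite lef_pV2 ?posrE// ler_nat ltnS.
  - have [Ux _] := h 0%N.
    have /nbhs_ballP[r /= r0 rU] : nbhs (x : 'rV[R]_d) U by exact: open_nbhs_nbhs.
    have [n nr] : exists n, n.+1%:R^-1 < r.
      have [n _ /(_ n (leqnn n)) nr] := near_infty_natSinv_lt (PosNum r0).
      by exists n.
    have [_ [y nUy bxy]] := h n; apply: nUy; apply: rU.
    apply: ball_sym; apply: le_ball bxy; exact: ltW.
have : \forall r \near (0 : R)^'+, r < n.+1%:R^-1 by apply: nbhs_right_lt; rewrite invr_gt0.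
apply: filter_app; near=> r => rn iota lt_r.
exists [set v | forall y, D y -> cell_index iota y = v -> U y].
apply: le_lt_trans hn; apply: prob_le.
- exact: measurable_cell_error.
- apply: measurableI => //; apply: measurableI => //; apply: sub_sigma_algebra.
  by apply: bigcup_open => y _; exact: ball_open.
move=> x [Dx]; rewrite /cell_error /= => h.
have GU : (forall y, D y -> cell_index iota y = cell_index iota x -> U y) -> U x.
  by apply.
have [Ux nG] : U x /\ ~ forall y, D y -> cell_index iota y = cell_index iota x -> U y.
  by have [?|?] := pselect (U x); tauto.
split=> //; move/existsNP: nG => [y /not_implyP[Dy /not_implyP[exy nUy]]].
exists y => //; apply: (cell_ball Ikb Dy Dx (lt_trans lt_r rn) exy).
Unshelve. all: by end_near. Qed.

Lemma measurable_cell_approximable (A : set T) : measurable A -> cell_approximable A.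
Proof.
apply: smallest_sub; last by move=> U; exact: cell_approximable_open.
split=> [|B hB|B hB].
- exact: cell_approximable0.
- by rewrite setTD; exact: cell_approximableC.
- exact: cell_approximable_bigcup.
Qed.

Lemma prob_seq_union (I : eqType) (s : seq I) (E : I -> set T) (c : R) :
  (forall i, measurable (D `&` E i)) -> (forall i, prob (E i) < c) -> 0 < c ->
  prob [set x | exists2 i, i \in s & E i x] <= (size s)%:R * c.
Proof.
move=> mE Ec c0.
suff [] : measurable (D `&` [set x | exists2 i, i \in s & E i x]) /\
    prob [set x | exists2 i, i \in s & E i x] <= (size s)%:R * c by [].
elim: s => [|j s [mS IH]].
  have e0 : D `&` [set x | exists2 i, i \in [::] & E i x] = set0.
    by apply/seteqP; split=> x //= [_ []].
  by rewrite e0 prob0// mul0r.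
have -> : [set x | exists2 i, i \in j :: s & E i x] =
    E j `|` [set x | exists2 i, i \in s & E i x].
  apply/seteqP; split=> x /=.
    by move=> [i]; rewrite inE => /predU1P[->|si Ei]; [left|right; exists i].
  by move=> [Ej|[i si Ei]]; [exists j|exists i]; rewrite // inE ?eqxx// si orbT.
split; first by rewrite setIUr; exact: measurableU.
rewrite (le_trans (probU mu (mE j) mS))//= -natr1 mulrDl mul1r addrC.
by rewrite lerD// ltW.
Qed.

Lemma condentropy_cell_sym_small (A : finType) (X : T -> A) (e : R) :
  rv D X -> 0 < e -> exists2 r : R, 0 < r &
  forall iota : prod_partition Ik, pp_norm iota < r ->
    entropy mu D (fun x => (X x, cell_sym iota x)) - entropy mu D (cell_sym iota) <= e.
Proof.
move=> mX e0.
have [x0 Dx0] : exists x, D x.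
  apply: contrapT => noD; have := D1.
  by rewrite (_ : D = set0) ?measure0 => [[/eqP]|]; [rewrite eq_sym oner_eq0|apply/seteqP; split=> x // Dx; apply: noD; exists x].
(* Fano's bound is [q + 2 * sqrt q * #|A|] over [ln 2]. For [q <= t ^+ 2] and [t <= 1/2] the
   numerator is at most [K * t], and [t] is chosen to make this at most [e * ln 2]. *)
pose K : R := 1 + 2 * #|A|%:R.
have K0 : 0 < K by rewrite ltr_pwDl// mulr_ge0.
pose t := Num.min (2^-1 : R) (e * ln 2 / K).
have t0 : 0 < t.
  by rewrite lt_min invr_gt0 divr_gt0 ?mulr_gt0 ?ln2_gt0//= ltr0n.
have t1 : t <= 2^-1 by rewrite ge_min lexx.
have tK : K * t <= e * ln 2.
  by rewrite mulrC -ler_pdivlMr// ge_min lexx orbT.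
have cA : 0 < #|A|%:R :> R by rewrite ltr0n; apply/card_gt0P; exists (X x0).
(* The [#|A|] error sets, each of probability below [c], together weigh at most [t ^+ 2]. *)
pose c := t ^+ 2 / #|A|%:R.
have c0 : 0 < c by rewrite divr_gt0// exprn_gt0.
have approx (a : A) : \forall r \near 0^'+,
    forall iota : prod_partition Ik, pp_norm iota < r ->
    exists G : set nat, prob (cell_error iota (D `&` [set x | X x = a]) G) < c.
  exact: (measurable_cell_approximable (mX a)).2.
have [r [r0 Hr]] := filter_ex (filterI (nbhs_right_gt (0 : R)) (filter_forall _ approx)).
exists r => // iota lt_r.
have [G hG] := choice (fun a => Hr a iota lt_r).
(* [Y] guesses [X] from the cell alone, with an arbitrary default. Outside all error sets [G a]
   holds exactly for [a = X x], so the guess is right there. *)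
pose Y x := if [pick a | `[< G a (cell_index iota x) >]] is Some a then a else X x0.
have YC : determined D Y (cell_sym iota).
  by move=> x y _ _ /(congr1 val) /= exy; rewrite /Y exy.
have mC := rv_cell_sym iota.
have mY : rv D Y := rv_determined mC YC.
apply: (@le_trans _ _ (entropy mu D (fun x => (X x, Y x)) - entropy mu D Y)).
  exact: condentropy_le.
pose E a := cell_error iota (D `&` [set x | X x = a]) (G a).
have mE a : measurable (D `&` E a) by apply: measurable_cell_error; exact: mX.
set q := prob [set x | X x <> Y x].
have mq : measurable (D `&` [set x | X x <> Y x]).
  by apply: (measurable_determined (rv_pair mX mY)) => x y _ _ [/= -> ->].
have qt : q <= t ^+ 2.
  have <- : (size (enum A))%:R * c = t ^+ 2 by rewrite -cardE /c mulrC divfK ?gt_eqF.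
  apply: le_trans (prob_seq_union (enum A) mE hG c0).
  apply: prob_le => //.
    have -> : D `&` [set x | exists2 a, a \in enum A & E a x] =
       \bigcup_(a in [set` enum A]) (D `&` E a).
      by apply/seteqP; split=> x /= => [[Dx [a ? ?]]|[a ? [? ?]]]; [exists a|split=> //; exists a].
    by apply: fin_bigcup_measurable.
  move=> x [Dx] /= XY; apply/not_exists2P => noE; apply: XY.
  have GX a : G a (cell_index iota x) <-> X x = a.
    have [|/contrapT] := noE a; first by rewrite mem_enum.
    by rewrite /E /cell_error /=; tauto.
  rewrite /Y; case: pickP => [a /asboolP /GX//|/(_ (X x))].
  by move=> /asboolP; rewrite GX.
have q0 : 0 <= q by exact: prob_ge0.
have sq : Num.sqrt q <= t.
  by rewrite -(ger0_norm (ltW t0)) -sqrtr_sqr ler_wsqrtr.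
have q1 : q < 1 by apply: (le_lt_trans qt); rewrite expr_lt1 ?ltW//; lra.
have := entropy_fano mD D1 mX mY q1; rewrite -/q => /le_trans; apply.
rewrite ler_pdivrMr ?ln2_gt0// (le_trans _ tK)// /K [leRHS]mulrDl mul1r lerD//.
  by apply: (le_trans qt); rewrite expr2 ler_piMl ?ltW//; lra.
by rewrite -mulr_natr mulrAC ler_wpM2l// mulr_ge0.
Qed.

End Approximation.

(** * Metric entropy in terms of finite-valued maps *)

Section MetricEntropy.
Context {R : realType} {d : nat}.
Local Notation T := (Rd R d).
Variables (mu : probability T R) (D : set T) (f : T -> T).
Hypothesis fD : forall x, D x -> D (f x).

Lemma entropy_rate_partE (n : nat) (A : 'I_n -> set T) (X : T -> 'I_n) :
  (forall x i, D x -> A i x <-> X x = i) ->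
  entropy_rate_part mu D f A = entropy_rate mu D f X.
Proof.
move=> AX; rewrite /entropy_rate_part /entropy_rate; congr (limn _).
apply/funext => L; congr (_ / _); apply: eq_bigr => w _.
congr (ent_term (fine (mu _))); apply/seteqP; split=> x /= [Dx h]; split=> //.
  by apply/ffunP => i; rewrite ffunE; apply/AX => //; exact: iterD_in.
by move=> i; apply/AX; [exact: iterD_in|rewrite -h ffunE].
Qed.

Lemma entropy_rate_le_metric_entropy (n : nat) (X : T -> 'I_n) : rv D X ->
  ((entropy_rate mu D f X)%:E <= metric_entropy mu D f)%E.
Proof.
move=> mX; apply: ereal_sup_ubound.
exists n, (fun i => D `&` [set x | X x = i]); split; last first.
  by rewrite (@entropy_rate_partE _ _ X)// => x i Dx /=; tauto.
split; first exact: mX.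
- by move=> i x [].
- move=> i j /eqP ij; apply/seteqP; split=> x //= [[_ Xi] [_ Xj]].
  by apply: ij; rewrite -Xi.
- by apply/seteqP; split=> [x [i _ []]//|x Dx]; exists (X x).
Qed.

Lemma meas_partition_rv (n : nat) (A : 'I_n -> set T) : D !=set0 ->
  meas_partition D A -> exists2 X : T -> 'I_n, rv D X &
    entropy_rate_part mu D f A = entropy_rate mu D f X.
Proof.
move=> [x0 Dx0] [mA AD disjA covA].
(* A default value for points outside [D]; ['I_n] is known to be inhabited because [D] is
   nonempty. *)
have [i0 _ _] : (\bigcup_(i in [set: 'I_n]) A i) x0 by rewrite covA.
pose X x := odflt i0 [pick i | `[< A i x >]].
have AX x i : D x -> A i x <-> X x = i.
  move=> Dx; rewrite /X; case: pickP => [j /asboolP Aj|noA] /=.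
    split=> [Ai|<-//]; apply/eqP/negP => /negP ji.
    by have : (A j `&` A i) x by []; rewrite disjA.
  by move: Dx; rewrite -{1}covA => -[j _ Aj]; move: (noA j); rewrite asboolT.
exists X; last exact: entropy_rate_partE.
move=> i; rewrite (_ : _ `&` _ = A i)//; apply/seteqP; split=> x /=.
  by move=> [Dx /AX]; apply.
by move=> Ai; have Dx := AD i x Ai; split=> //; apply/AX.
Qed.

End MetricEntropy.

(** The outer limit, over all product partitions as the norm tends to 0, is phrased by
    neighbourhoods in [\bar R] because the metric entropy may be infinite. Existence of each inner
    limit [hstar iota] is part of the claim. *)
Theorem theorem3 (R : realType) (d : nat) (Ik : 'I_d -> interval R)
  (mu : probability (Rd R d) R) (f : Rd R d -> Rd R d) :
  (forall k, bounded_itv (Ik k)) ->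
  mu (box Ik) = 1%E ->
  (forall x, box Ik x -> box Ik (f x)) ->
  measurable_fun (box Ik) f ->
  (forall A, measurable A -> A `<=` box Ik ->
     mu (box Ik `&` f @^-1` A) = mu A) ->
  (forall A, measurable A -> A `<=` box Ik ->
     box Ik `&` f @^-1` A = A -> mu A = 0%E \/ mu A = 1%E) ->
  exists hstar : prod_partition Ik -> R,
    (forall iota : prod_partition Ik,
       (fun L : nat =>
          rank_block_entropy mu (box Ik) (simple_obs iota f) L / (L%:R - 1))
         @ \oo --> hstar iota) /\
    (forall U : set (\bar R), nbhs (metric_entropy mu (box Ik) f) U ->
       exists2 delta : R, 0 < delta &
         forall iota : prod_partition Ik, pp_norm iota < delta ->
           U (hstar iota)%:E).
Proof.
move=> Ikb D1 fD mf f_inv _.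
have mD : measurable (box Ik : set (Rd R d)) := measurable_box Ik.
pose hstar (iota : prod_partition Ik) := entropy_rate mu (box Ik) f (cell_sym iota).
exists hstar; split=> [iota|].
  exact: (cvg_rank_block_entropy mD D1 fD mf f_inv (rv_cell_sym iota)).
have hstar_le iota : ((hstar iota)%:E <= metric_entropy mu (box Ik) f)%E.
  by apply: entropy_rate_le_metric_entropy => //; exact: rv_cell_sym.
have hstar_ge (M : R) : (M%:E < metric_entropy mu (box Ik) f)%E ->
    exists2 delta : R, 0 < delta & forall iota : prod_partition Ik,
      pp_norm iota < delta -> M < hstar iota.
  move=> /ereal_sup_gt[_ [n [A [pA ->]]]]; rewrite lte_fin.
  have D0 : (box Ik : set (Rd R d)) !=set0.
    apply: contrapT => /set0P/negP/negPn/eqP D0; move: D1.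
    by rewrite D0 measure0 => -[/eqP]; rewrite eq_sym oner_eq0.
  have [X mX ->] := meas_partition_rv mu fD D0 pA.
  set h := entropy_rate _ _ _ X => Mh.
  (* Losing half of the gap leaves [hstar iota >= (h + M) / 2 > M]. *)
  have e0 : 0 < (h - M) / 2 by rewrite divr_gt0// subr_gt0.
  have [delta delta0 H] := condentropy_cell_sym_small Ikb D1 mX e0.
  exists delta => // iota /H le_e.
  have := entropy_rate_le mD D1 fD mf f_inv mX (rv_cell_sym iota).
  by rewrite -/h -/(hstar iota) => le_h; lra.
(* Neighbourhoods take a different form at a real point and at [+oo]; the value [-oo] is
   incompatible with the real lower bound [hstar iota]. *)
move=> U; case: (metric_entropy mu _ f) hstar_le hstar_ge => [m|le_h ge_h|le_h _ _].
- move=> le_h ge_h hU.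
  have /nbhs_ballP[e /= e0 eU] : nbhs m (fun r : R => U r%:E) by exact: hU.
  have /ge_h[delta delta0 H] : ((m - e)%:E < m%:E)%E by rewrite lte_fin ltrBlDr ltrDl.
  exists delta => // iota /H lt_h; apply: eU.
  have := le_h iota; rewrite lee_fin => le_m.
  by rewrite /ball/= ger0_norm ?subr_ge0//; move: lt_h; rewrite ltrBlDr ltrBlDr addrC.
- move=> [M [_ MU]]; have /ge_h[delta delta0 H] := ltry M.
  by exists delta => // iota /H lt_h; apply: MU; rewrite lte_fin.
- by exists 1 => // iota _; have := le_h iota.
Qed.
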